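(* Let $S$ be a semigroup and let $n\ge 2$. If $S$ satisfies a (nontrivial) $n$-variable semigroup identity $\Pi: u=v$, then $S$ also satisfies a (nontrivial) $2$-variable semigroup identity $\widehat\Pi:\widehat u=\widehat v$ with exponent set $\exp(\widehat\Pi)=\{1,2\}$.
   Context: Let $\mathcal X=\{x_1,x_2,\dots\}$ be a countably infinite set of variables and $\mathcal X^+$ the free semigroup on $\mathcal X$, whose elements are called words. Every (nonempty) word is written uniquely as $w=x_{i_1}^{t_1}\cdots x_{i_m}^{t_m}$ with $t_k\ge 1$ and $x_{i_k}\ne x_{i_{k+1}}$ for every $k$. The content $\operatorname{cont}(w)$ is the set of variables occurring in $w$, and the exponent set is $\exp(w)=\{t_1,\dots,t_m\}$. A (nontrivial) semigroup identity is a formal equality $\Pi:u=v$ where $u,v\in\mathcal X^+$ are two different words. It is an $n$-variable identity if $|\operatorname{cont}(u)\cup\operatorname{cont}(v)|=n$, and its exponent set is $\exp(\Pi)=\exp(u)\cup\exp(v)$. A semigroup $S$ satisfies $\Pi:u=v$ if $\phi(u)=\phi(v)$ for every semigroup morphism $\phi:\mathcal X^+\to S$. *)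

(* Defs.v *)
From HB Require Import structures.
From mathcomp Require Import all_boot finmap.

Set Implicit Arguments.
Unset Strict Implicit.
Unset Printing Implicit Defensive.

Local Open Scope fset_scope.

(* The free semigroup on the variables x_1, x_2, ...; the natural number i
   stands for the variable x_(i+1), and the product is concatenation. *)
Definition word := {s : seq nat | s != [::]}.

HB.instance Definition _ := Choice.on word.
HB.instance Definition _ := SubType.on word.

Fact word_cat_neq0 (u v : word) : val u ++ val v != [::].
Proof. by case: u => -[]. Qed.

Definition word_mul (u v : word) : word :=
  exist _ (val u ++ val v) (word_cat_neq0 u v).

Fact word_mulA : associative word_mul.
Proof. by move=> u v w; apply: val_inj; rewrite /= catA. Qed.

HB.instance Definition _ := isSemigroup.Build word word_mulA.

(* The sequence (i_1, t_1), ..., (i_m, t_m) of the reduced form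
   x_{i_1}^{t_1} ... x_{i_m}^{t_m}; [power_formP] and [power_form_uniq] below
   show that it exists and is unique. *)
Fixpoint power_form (s : seq nat) : seq (nat * nat) :=
  if s is x :: s' then
    if power_form s' is (y, t) :: r then
      if x == y then (y, t.+1) :: r else [:: (x, 1), (y, t) & r]
    else [:: (x, 1)]
  else [::].

Definition reduced_form (r : seq (nat * nat)) : bool :=
  all (fun p => 0 < p.2) r && sorted (fun p q => p.1 != q.1) r.

Lemma power_formP (s : seq nat) :
  reduced_form (power_form s) /\ tally_seq (power_form s) = s.
Proof.
elim: s => [|x s [IHr IHs]] //=; move: IHr IHs.
rewrite /reduced_form /tally_seq; case: (power_form s) => [|[y t] r] /=.
  by move=> _ <-.
case/andP=> /andP[t_gt0 r_gt0] rP <-; case: eqVneq => [->|xNy] /=.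
  by rewrite r_gt0; case: r rP {r_gt0}.
by rewrite t_gt0 r_gt0 xNy rP.
Qed.

Lemma power_form_uniq (r : seq (nat * nat)) :
  reduced_form r -> power_form (tally_seq r) = r.
Proof.
rewrite /reduced_form /tally_seq; elim: r => [|[x t] r IHr] //=.
case/andP=> /andP[t_gt0 r_gt0] rP.
have {}IHr : power_form (flatten [seq nseq p.2 p.1 | p <- r]) = r.
  by apply: IHr; rewrite r_gt0 (path_sorted rP).
have xNr k : power_form (nseq k.+1 x ++ tally_seq r) = (x, k.+1) :: r.
  elim: k => [|k IHk] /=; last by move: IHk => /= ->; rewrite eqxx.
  by rewrite IHr; case: r rP {IHr r_gt0} => [|[y k] r] //= /andP[/negPf-> _].
by case: t t_gt0 rP => // t _ _; apply: xNr.
Qed.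

Definition cont (w : word) : {fset nat} := [fset x in val w].

Definition exps (w : word) : {fset nat} :=
  [fset t in [seq p.2 | p <- power_form (val w)]].

(* An identity u = v is given by its two sides; nontriviality, u != v, is
   stated separately. *)
Definition id_nvars (u v : word) : nat := #|` cont u `|` cont v|.

Definition id_exps (u v : word) : {fset nat} := exps u `|` exps v.

Definition satisfies (S : magmaType) (u v : word) : Prop :=
  forall phi : {multiplicative word -> S}, phi u = phi v.

(* Main.v *)
(* The substitution x_i |-> (ab)^i a^2 b is injective on words, because a^2
   marks where the image of each letter ends; and every image of a nonempty word
   is a product of blocks ab and a^2 b, hence has exponent set {1, 2}. *)
Require Import Defs.
From HB Require Import structures.
From mathcomp Require Import all_boot finmap.

Set Implicit Arguments.
Unset Strict Implicit.
Unset Printing Implicit Defensive.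

Local Open Scope fset_scope.

(** The letters a and b are the variables [0] and [1]. *)
Fixpoint encode_var (i : nat) : seq nat :=
  if i is j.+1 then [:: 0, 1 & encode_var j] else [:: 0; 0; 1].

Definition encode_seq (s : seq nat) : seq nat := flatten (map encode_var s).

(** The default [0] admits the empty sequence: [head 0 s = 0] says that [s] is empty or starts with
    a. *)
Lemma head_encode_seq (s : seq nat) : head 0 (encode_seq s) = 0.
Proof. by case: s => [|[|i] s]. Qed.

Lemma head_encode_var_cat (i : nat) (s : seq nat) :
  head 0 (encode_var i ++ s) = 0.
Proof. by case: i. Qed.

(** The codes form a prefix code: the letter after the first a tells whether another block ab or the
    final aab is being read. *)
Lemma encode_var_cat_inj (i j : nat) (s t : seq nat) :
  encode_var i ++ s = encode_var j ++ t -> i = j /\ s = t.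
Proof.
elim: i j => [|i IHi] [|j] //=; first by case.
by case=> /IHi[-> ->].
Qed.

Lemma encode_seq_inj : injective encode_seq.
Proof.
elim=> [|i s IHs] [|j t] //=; first by case: j.
  by case: i.
by rewrite /encode_seq /= => /encode_var_cat_inj[-> /IHs ->].
Qed.

Lemma mem_encode_var (i : nat) : encode_var i =i [:: 0; 1].
Proof.
by elim: i => [|i IHi] x; rewrite /= !inE ?IHi ?inE; do 2?case: eqP.
Qed.

Lemma mem_encode_seq (s : seq nat) : s != [::] -> encode_seq s =i [:: 0; 1].
Proof.
elim: s => // i [_ _ x|j s IHs _ x]; rewrite /encode_seq /= mem_cat mem_encode_var.
  by rewrite orbF.
by rewrite [X in _ || X]IHs // orbb.
Qed.

(** The b closing the block cannot merge with [s], which is empty or starts with a. *)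
Lemma power_form_block (s : seq nat) : head 0 s = 0 ->
  power_form [:: 0, 1 & s] = [:: (0, 1), (1, 1) & power_form s].
Proof.
case: s => [|[|//] s] //= _.
by case: (power_form s) => [|[[|y] t] r].
Qed.

Lemma power_form_square_block (s : seq nat) : head 0 s = 0 ->
  power_form [:: 0, 0, 1 & s] = [:: (0, 2), (1, 1) & power_form s].
Proof.
(* Peel off one a: it raises the first exponent of the block ab from 1 to 2. *)
by move=> s0; rewrite -cat1s [LHS]/= -/(power_form [:: 0, 1 & s]) power_form_block.
Qed.

(** Stated on sequences rather than words, so that inductions may pass through the empty tail. *)
Definition exponents (s : seq nat) : seq nat := [seq p.2 | p <- power_form s].

(** Each ab contributes only the exponent 1, and the final aab contributes 2 and 1; [=i] ignores
    repetitions. *)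
Lemma exponents_encode_var_cat (i : nat) (s : seq nat) : head 0 s = 0 ->
  exponents (encode_var i ++ s) =i [:: 1, 2 & exponents s].
Proof.
move=> s0; elim: i => [|i IHi] x; rewrite /exponents.
  rewrite [encode_var 0 ++ s]/= power_form_square_block //= !inE.
  by rewrite orbCA.
rewrite [encode_var _ ++ s]/= power_form_block ?head_encode_var_cat //= !inE.
by rewrite IHi !inE !orbA !orbb.
Qed.

Lemma exponents_encode_seq (s : seq nat) :
  s != [::] -> exponents (encode_seq s) =i [:: 1; 2].
Proof.
elim: s => // i s IHs _ x.
rewrite [encode_seq _]/= exponents_encode_var_cat ?head_encode_seq //.
case: s IHs => // j s IHs; rewrite !inE [x \in _]IHs // !inE.
by do 2?case: eqP.
Qed.

Fact encode_seq_neq0 (w : word) : encode_seq (val w) != [::].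
Proof. by case: w => -[|[|i] s]. Qed.

Definition encode (w : word) : word :=
  exist _ (encode_seq (val w)) (encode_seq_neq0 w).

Lemma encode_inj : injective encode.
Proof. by move=> u v /(congr1 val)/= /encode_seq_inj/val_inj. Qed.

Lemma encodeM : {morph encode : u v / word_mul u v}.
Proof.
by move=> u v; apply: val_inj; rewrite /= /encode_seq map_cat flatten_cat.
Qed.

HB.instance Definition _ := isMultiplicative.Build word word encode encodeM.

(** Since [encode] is an endomorphism of the free semigroup, [phi \o encode] is again a morphism to
    [S], to which the given identity applies. *)
Lemma satisfies_encode (S : magmaType) (u v : word) :
  satisfies S u v -> satisfies S (encode u) (encode v).
Proof. by move=> S_uv phi; apply: (S_uv (phi \o encode)). Qed.

Lemma cont_encode (w : word) : cont (encode w) = [fset 0; 1].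
Proof. by apply/fsetP=> x; rewrite !inE /= mem_encode_seq ?inE ?(valP w). Qed.

Lemma exps_encode (w : word) : exps (encode w) = [fset 1; 2].
Proof.
apply/fsetP=> x; rewrite !inE /=.
by rewrite [LHS]exponents_encode_seq ?inE ?(valP w).
Qed.

Theorem theorem3p10 (S : magmaType) (mulSA : associative (@mul S))
    (n : nat) (n_ge2 : 2 <= n) (u v : word) (uNv : u <> v)
    (uv_nvars : id_nvars u v = n) (S_uv : satisfies S u v) :
  exists u' v' : word,
    [/\ u' <> v', id_nvars u' v' = 2, id_exps u' v' = [fset 1; 2]
      & satisfies S u' v'].
Proof.
exists (encode u), (encode v); split.
- by move/encode_inj.
- by rewrite /id_nvars !cont_encode fsetUid cardfs2.
- by rewrite /id_exps !exps_encode fsetUid.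
- exact: satisfies_encode.
Qed.
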